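(* Let $\boldsymbol{v}_a,\boldsymbol{v}_b\in\mathbb{S}^1\subset\mathbb{R}^2$ be unit vectors, $\boldsymbol{q}\in\mathbb{R}^2$ and $\mu_a,\mu_b\in\mathbb{R}$ such that $\boldsymbol{v}_b+\boldsymbol{q}=\mu_a\boldsymbol{v}_a$ and $\boldsymbol{v}_a+\boldsymbol{q}=\mu_b\boldsymbol{v}_b$ (i.e. $a,b$ are geometric closed twins with strengths $\mu_a,\mu_b$ with respect to the common vector $\boldsymbol{q}$). Then one of the following holds: (1) $\boldsymbol{v}_a=\boldsymbol{v}_b$ and $\mu_a=\mu_b$; (2) $\boldsymbol{v}_a=-\boldsymbol{v}_b$, $\mu_a+\mu_b=-2$ and $\mu_a\neq-1$; (3) $\mu_a=\mu_b=-1$ and $\boldsymbol{v}_a+\boldsymbol{v}_b+\boldsymbol{q}=\boldsymbol{0}$ (with $\boldsymbol{v}_a,\boldsymbol{v}_b\in\mathbb{S}^1$ otherwise unconstrained).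
   Context: For a state $\boldsymbol{\theta}$ of the Kuramoto model on a graph, the phasor of node $i$ is $\boldsymbol{v}_i=(\cos\theta_i,\sin\theta_i)$. Two nodes $a,b$ are called geometric closed twins with strengths $\mu_a,\mu_b\in\mathbb{R}$ with respect to a common vector $\boldsymbol{q}\in\mathbb{R}^2$ if $\boldsymbol{v}_b+\boldsymbol{q}=\mu_a\boldsymbol{v}_a$ and $\boldsymbol{v}_a+\boldsymbol{q}=\mu_b\boldsymbol{v}_b$. *)

(* Defs.v *)
From HB Require Import structures.
From mathcomp Require Import all_boot all_order all_algebra reals.

Set Implicit Arguments.
Unset Strict Implicit.
Unset Printing Implicit Defensive.

Import Order.TTheory GRing.Theory Num.Theory.
Local Open Scope ring_scope.

(* The norm `|v| that MathComp-Analysis puts on matrices is the sup norm, so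
   the Euclidean norm is defined here. *)
Definition enorm (R : realType) (n : nat) (v : 'rV[R]_n) : R :=
  Num.sqrt (\sum_(i < n) v 0 i ^+ 2).

Definition unit_circle (R : realType) : pred 'rV[R]_2 :=
  [pred v | enorm v == 1].
Arguments unit_circle : clear implicits.

(* The nodes a and b enter only through their phasors v_a and v_b. *)
Definition geometric_closed_twins (R : realType) (v_a v_b q : 'rV[R]_2)
    (mu_a mu_b : R) : Prop :=
  v_b + q = mu_a *: v_a /\ v_a + q = mu_b *: v_b.

(* Main.v *)
(* Subtracting the twin equations gives (1 + mu_a) v_a = (1 + mu_b) v_b; taking
   norms, 1 + mu_a = +- (1 + mu_b), and the three cases are the two signs and the
   vanishing of both sides. *)
Require Import Defs.
From HB Require Import structures.
From mathcomp Require Import all_boot all_order all_algebra reals.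
From mathcomp Require Import ring lra.

Set Implicit Arguments.
Unset Strict Implicit.
Unset Printing Implicit Defensive.

Import Order.TTheory GRing.Theory Num.Theory.
Local Open Scope ring_scope.

(** The sum [v_a + v_b + q] equals both [(1 + mu_a) *: v_a] and [(1 + mu_b) *: v_b], so by [enormZ]
    the two scalars agree up to sign. If the sum is zero, both vanish; otherwise they cancel, and
    their relative sign decides whether the phasors are equal or opposite. *)

Lemma enormZ (R : realType) (n : nat) (c : R) (v : 'rV[R]_n) :
  enorm (c *: v) = `|c| * enorm v.
Proof.
rewrite /enorm -sqrtr_sqr -sqrtrM ?sqr_ge0// mulr_sumr.
by congr Num.sqrt; apply: eq_bigr => i _; rewrite mxE exprMn.
Qed.

Theorem theorem5p2 (R : realType) (v_a v_b q : 'rV[R]_2) (mu_a mu_b : R)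
    (hv_a : v_a \in unit_circle R) (hv_b : v_b \in unit_circle R)
    (htwins : geometric_closed_twins v_a v_b q mu_a mu_b) :
  (v_a = v_b /\ mu_a = mu_b) \/
  [/\ v_a = - v_b, mu_a + mu_b = - 2 & mu_a <> - 1] \/
  [/\ mu_a = - 1, mu_b = - 1 & v_a + v_b + q = 0].
Proof.
move: hv_a hv_b htwins; rewrite !inE => /eqP na /eqP nb [ea eb].
have e : (1 + mu_a) *: v_a = (1 + mu_b) *: v_b.
  by rewrite !scalerDl !scale1r -ea -eb addrCA.
have /eqP := congr1 (@enorm R 2) e.
rewrite !enormZ na nb !mulr1 eqr_norm2 => h.
have [a0|a0] := eqVneq (1 + mu_a) 0.
  have b0 : 1 + mu_b = 0.
    by case/orP: h; rewrite a0 eq_sym ?oppr_eq0 => /eqP.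
  right; right; split; [by lra | by lra |].
  by rewrite -addrA ea -{1}(scale1r v_a) -scalerDl a0 scale0r.
case/orP: h => /eqP h.
  left; split; last exact: addrI h.
  by apply: (scalerI a0); rewrite e h.
right; left; split.
- by apply: (scalerI a0); rewrite e scalerN -scaleNr h opprK.
(* Writing [mu_a] as [- 1 + (1 + mu_a)] exposes the scalar that [h] rewrites. *)
- by rewrite -[mu_a](addKr 1) h; ring.
- by move=> m; rewrite m subrr eqxx in a0.
Qed.
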